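(* Let $\varepsilon>0$ be given. Let $j,k$ be integers with $0<j\le k$ and $\gcd(j,k)=1$. Let $m$ be an integer with $m\ge 2/(k\varepsilon)+1$ such that $mj\equiv 1 \pmod{k}$. Let $l$ be a positive integer, put $n=k(m^2+1)$ and $t=2m+ln-j(m^2+1)$. Then \[ S(mt+1,nt)=l-3-\frac{j}{k}+E \] for some real number $E$ with $0<E<\varepsilon$.
   Context: For a real number $x$, the sawtooth function is $((x))=x-\lfloor x\rfloor-1/2$ if $x\notin\mathbb{Z}$ and $((x))=0$ if $x\in\mathbb{Z}$. For a positive integer $n$ and an integer $m$ with $\gcd(m,n)=1$, the Dedekind sum is $s(m,n)=\sum_{k=1}^{n}((k/n))((mk/n))$, and $S(m,n)=12\,s(m,n)$. *)

(* Defs.v *)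
From mathcomp Require Import all_boot all_order all_algebra.
From mathcomp Require Import reals.

Set Implicit Arguments.
Unset Strict Implicit.
Unset Printing Implicit Defensive.

Import Order.TTheory GRing.Theory Num.Theory.

Local Open Scope ring_scope.

Definition sawtooth (R : realType) (x : R) : R :=
  if x \is a Num.int then 0 else x - (Num.floor x)%:~R - 1 / 2.

(** The Dedekind sum s(m, n) for n > 0 and gcd(m, n) = 1.  The modulus is an
    [int] so that it can be an expression with subtraction; [`|n|%N] is n
    itself as a [nat] when n > 0, and values at n <= 0 are junk. *)
Definition dedekind_sum (R : realType) (m n : int) : R :=
  \sum_(1 <= k < `|n|%N.+1)
    sawtooth (k%:R / n%:~R : R) * sawtooth (m%:~R * k%:R / n%:~R : R).

Definition dedekind_S (R : realType) (m n : int) : R :=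
  12 * dedekind_sum R m n.

(* Main.v *)
(** Put M = m t + 1 and N = n t, so that M / N = m / n + 1 / N.  For x modulo N
    let u = x / N, w = m x / n and v = u + w = M x / N.  The defect
    ((v)) - ((u)) - ((w)) is 0 if n divides x and 1/2 in absolute value otherwise.
    Squaring and summing over x gives s(M, N), since the sums of squares are
    explicit and the two other cross terms cancel: by the distribution relation
    the sum of ((u))((w)) is s(m, n), while that of ((v))((w)) is the sum of
    ((M a / n))((m a / n)) over a modulo n, which is again s(m, n) because
    M = m^2 modulo n.  Hence S(M, N) = t / n + 2 / (n t) - 3, that is,
    E = 2 m / n + 2 / (n t). *)
Require Import Defs.
From mathcomp Require Import all_boot all_order all_algebra.
From mathcomp Require Import reals.
From mathcomp Require Import ring lra zify.

Import Order.TTheory GRing.Theory Num.Theory.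

Local Open Scope ring_scope.

(** * Sums over residue systems *)

(** Multiplication by the unit [a] followed by the shift by [q] permutes the residues modulo [N],
    and [F] depends only on the residue. *)
Lemma sum_periodic_affine (V : zmodType) (N : nat) (F : int -> V) (a q : int) :
    coprimez a N -> (forall i z, F (i + z * N%:Z) = F i) ->
  \sum_(b < N) F (a * b%:Z + q) = \sum_(b < N) F b%:Z.
Proof.
case: N F => [|p] F co_aN Fper; first by rewrite !big_ord0.
set N := p.+1 in co_aN Fper *.
have NZ : N%:Z != 0 by [].
have Fmod i : F i = F (i %% N)%Z.
  by rewrite {1}(divz_eq i N) addrC Fper.
pose h (b : 'I_N) : 'I_N := inord `|((a * b%:Z + q) %% N)%Z|%N.
have hE b : (h b)%:Z = ((a * b%:Z + q) %% N)%Z.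
  have ge0 := modz_ge0 (a * b%:Z + q) NZ.
  have lt := ltz_pmod (a * b%:Z + q) (isT : 0 < N%:Z).
  rewrite inordK ?gez0_abs //.
  by rewrite -ltz_nat gez0_abs.
have h_inj : injective h.
  move=> b b' /(congr1 (fun i : 'I_N => i%:Z)); rewrite !hE => /eqP.
  rewrite eqz_mod_dvd opprD addrACA subrr addr0 -mulrBr.
  rewrite Gauss_dvdzr 1?coprimez_sym // -eqz_mod_dvd !modz_nat !modn_small //.
  by move=> /eqP [] /val_inj.
rewrite [RHS](reindex_inj h_inj) /=.
by apply: eq_bigr => b _; rewrite Fmod hE.
Qed.

Lemma sum_ord_mul (V : nmodType) (n t : nat) (F : nat -> V) :
  \sum_(x < n * t) F x = \sum_(a < n) \sum_(b < t) F (a + b * n)%N.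
Proof.
rewrite exchange_big /=; elim: t => [|t IHt]; first by rewrite muln0 !big_ord0.
rewrite big_ord_recr /= -IHt mulnS addnC big_split_ord /=.
by congr (_ + _); apply: eq_bigr => a _; rewrite addnC mulnC.
Qed.

(** * The sawtooth function: periodicity, distribution relation, sum of squares *)

Section Sawtooth.
Variable R : realType.
Implicit Types x y u w : R.

Local Notation st := (@sawtooth R).

Lemma sawtoothDz x (z : int) : st (x + z%:~R) = st x.
Proof.
rewrite /sawtooth rpredDr ?intr_int //; case: ifP => // _.
by rewrite floorDrz ?intr_int // intrKfloor intrD; ring.
Qed.

Lemma sawtooth_int x : x \is a Num.int -> st x = 0.
Proof. by rewrite /sawtooth => ->. Qed.

Lemma sawtooth_itv x : 0 < x < 1 -> st x = x - 1 / 2.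
Proof.
move=> /andP[x0 x1]; have fx : Num.floor x = 0.
  by apply: floor_def; rewrite add0r (ltW x0) x1.
rewrite /sawtooth fx subr0; case: ifP => //.
by rewrite intrEfloor fx => /eqP xE; rewrite -xE ltxx in x0.
Qed.

(** The defect is 1/2 if the fractional parts of [u] and [w] add up to less than 1, and -1/2 if
    there is a carry. *)
Lemma sawtoothD_sqr u w :
    u \isn't a Num.int -> w \isn't a Num.int -> u + w \isn't a Num.int ->
  (st (u + w) - st u - st w) ^+ 2 = 1 / 4.
Proof.
move=> uN wN uwN; rewrite /sawtooth (negbTE uN) (negbTE wN) (negbTE uwN).
have [] := (floor_itv u, floor_itv w).
move: (Num.floor u) (Num.floor w) => a b /andP[au ua] /andP[bw wb].
rewrite !intrD in ua wb.
have [lt|ge] := ltP (u + w) ((a + b + 1)%:~R).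
  have -> : Num.floor (u + w) = a + b.
    by apply: floor_def; rewrite lt intrD lerD.
  by rewrite intrD; field.
have -> : Num.floor (u + w) = a + b + 1.
  by apply: floor_def; rewrite ge !intrD; lra.
by rewrite !intrD; field.
Qed.

(** Shifting [y] by a multiple of 1/t only permutes the terms, so [y] may be replaced by [y'] with 0
    <= t y' < 1. All points y' + b/t then lie in [0, 1), where the values form an arithmetic
    progression, except at 0. *)
Lemma sum_sawtooth_distr (t : nat) y : (0 < t)%N ->
  \sum_(b < t) st (y + b%:R / t%:R) = st (t%:R * y).
Proof.
move=> t_gt0; have tR : 0 < t%:R :> R by rewrite ltr0n.
have tR0 : t%:R != 0 :> R by rewrite gt_eqF.
pose q := Num.floor (t%:R * y); pose y' := y - q%:~R / t%:R.
have /andP[qy yq] := floor_itv (t%:R * y); rewrite -/q intrD in qy yq.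
have yE : y = y' + q%:~R / t%:R by rewrite /y' subrK.
have ty' : t%:R * y = t%:R * y' + q%:~R by rewrite {1}yE; field.
have ty'0 : 0 <= t%:R * y' by lra.
have ty'1 : t%:R * y' < 1 by lra.
rewrite ty' sawtoothDz.
pose F (i : int) := st (y' + i%:~R / t%:R).
have Fper i z : F (i + z * t%:Z) = F i.
  rewrite /F -[RHS](sawtoothDz _ z); congr (st _).
  by rewrite intrD intrM; field.
have -> : \sum_(b < t) st (y + b%:R / t%:R)
   = \sum_(b < t) F (1 * b%:Z + q).
  apply: eq_bigr => b _; rewrite /F mul1r yE intrD; congr (st _).
  by field.
rewrite sum_periodic_affine // /coprimez; last by rewrite gcd1z.
have y'0 : 0 <= y' by rewrite -(pmulr_rge0 _ tR).
have sumid (p : nat) : \sum_(b < p) (y' + b%:R / t%:R - 1 / 2)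
   = p%:R * (y' - 1 / 2) + p%:R * (p%:R - 1) / (2 * t%:R).
  elim: p => [|p IHp]; first by rewrite big_ord0 !mul0r add0r.
  by rewrite big_ord_recr /= IHp -natr1; field.
have y'b (b : 'I_t) : y' + b%:R / t%:R < 1.
  rewrite -(ltr_pM2l tR) mulr1 mulrDr mulrCA divff // mulr1.
  have : b%:R + 1 <= t%:R :> R by rewrite natr1 ler_nat.
  lra.
have [y'E|y'N0] := eqVneq y' 0; last first.
  have y'gt : 0 < y' by rewrite lt_neqAle eq_sym y'N0.
  rewrite sawtooth_itv ?ty'1 ?mulr_gt0 // /F.
  under eq_bigr => b _.
    rewrite sawtooth_itv ?y'b ?andbT; last first.
      by rewrite ltr_pwDl // divr_ge0 ?ler0n.
    over.
  by rewrite sumid; field.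
(* For y' = 0 the term b = 0 is 0 instead of the -1/2 counted by [sumid]; hence -1/2 is added to
   both sides below. *)
rewrite y'E mulr0 [RHS]sawtooth_int // /F.
case: t t_gt0 tR tR0 @q @y' qy yq yE ty' ty'0 ty'1 F Fper y'0 sumid y'b y'E => [//|p].
move=> _ tR tR0 q y' _ _ _ _ _ _ F _ _ sumid y'b y'E.
have := sumid p.+1.
rewrite !big_ord_recl /= y'E mul0r addr0 [st 0]sawtooth_int // add0r.
under eq_bigr => b _ do rewrite add0r.
under [in X in _ -> X]eq_bigr => b _.
  rewrite sawtooth_itv; last first.
    have := y'b (lift ord0 b); rewrite y'E add0r => ->.
    by rewrite divr_gt0 // ltr0n.
  rewrite add0r.
  over.
move=> sumE; apply: (addrI (- (1 / 2))); rewrite add0r; apply: etrans sumE _; field.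
by rewrite nat1r tR0.
Qed.

Lemma sum_sawtooth_sqr (N : nat) : (0 < N)%N ->
  \sum_(x < N) st (x%:R / N%:R) ^+ 2
    = (N%:R - 1) * (N%:R - 2) / (12 * N%:R).
Proof.
case: N => // p _; set c : R := p.+1%:R.
have c0 : 0 < c by rewrite ltr0n.
have cE : c = p%:R + 1 by rewrite /c natr1.
rewrite big_ord_recl mul0r sawtooth_int // expr0n add0r; clearbody c.
have sumid (q : nat) : \sum_(i < q) (i.+1%:R / c - 1 / 2) ^+ 2
   = q%:R * (q%:R + 1) * (2 * q%:R + 1) / (6 * c ^+ 2)
     - q%:R * (q%:R + 1) / (2 * c) + q%:R / 4.
  elim: q => [|q IHq]; first by rewrite big_ord0 !mul0r subr0 addr0.
  by rewrite big_ord_recr /= IHq -[q.+1%:R]natr1; field; rewrite gt_eqF.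
rewrite (eq_bigr (fun i : 'I_p => (i.+1%:R / c - 1 / 2) ^+ 2)).
  have pE : p%:R = c - 1 by rewrite cE addrK.
  by rewrite sumid pE; field; rewrite gt_eqF.
move=> i _; rewrite /= sawtooth_itv //.
by rewrite divr_gt0 ?ltr0n //= ltr_pdivrMr // mul1r cE natr1 ltr_nat ltnS ltn_ord.
Qed.

(** * Sums of sawtooth products and changes of modulus *)

Lemma intr_div_int (z : int) (N : nat) : (0 < N)%N ->
  ((z%:~R / N%:R : R) \is a Num.int) = (N%:Z %| z)%Z.
Proof.
move=> N_gt0; have NR : N%:R != 0 :> R by rewrite pnatr_eq0 -lt0n.
apply/idP/dvdzP => [/intrP[q qE]|[q ->]]; last first.
  by rewrite intrM mulfK // intr_int.
exists q; apply: (mulrIz (oner_neq0 R)).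
by rewrite intrM -qE divfK.
Qed.

(** The range 1..N becomes 0..N-1 because both end terms are taken at integers, where the sawtooth
    vanishes. *)
Lemma dedekind_sumE (m : int) (N : nat) : (0 < N)%N ->
  dedekind_sum R m N = \sum_(x < N)
    st (x%:R / N%:R : R) * st (m%:~R * x%:R / N%:R).
Proof.
move=> N_gt0; have NR : N%:R != 0 :> R by rewrite pnatr_eq0 -lt0n.
pose F (x : nat) := st (x%:R / N%:R) * st (m%:~R * x%:R / N%:R).
have F0 : F 0 = 0 by rewrite /F mulr0n mul0r sawtooth_int ?mul0r.
have FN : F N = 0 by rewrite /F divff // sawtooth_int ?rpred1 ?mul0r.
rewrite -(big_mkord xpredT F) big_ltn // F0 add0r.
by rewrite /dedekind_sum absz_nat big_nat_recr //= -/(F N) FN addr0.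
Qed.

(** Write x = a + b n. The second factor depends only on [a]; in the first, c b runs through the
    residues modulo [t], so the distribution relation at c a / (n t) yields ((c a / n)). *)
Lemma sum_sawtooth_lift (n t : nat) (c d : int) :
    (0 < n)%N -> (0 < t)%N -> coprimez c t ->
  \sum_(x < n * t) st (c%:~R * x%:R / (n%:R * t%:R) : R)
      * st (d%:~R * x%:R / n%:R)
  = \sum_(a < n) st (c%:~R * a%:R / n%:R : R)
      * st (d%:~R * a%:R / n%:R).
Proof.
move=> n_gt0 t_gt0 co_ct.
have nR : n%:R != 0 :> R by rewrite pnatr_eq0 -lt0n.
have tR : t%:R != 0 :> R by rewrite pnatr_eq0 -lt0n.
rewrite (sum_ord_mul _ _ _ (fun x : nat => st (c%:~R * x%:R / (n%:R * t%:R) : R)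
      * st (d%:~R * x%:R / n%:R))).
apply: eq_bigr => a _.
transitivity (\sum_(b < t) st (c%:~R * a%:R / (n%:R * t%:R)
    + (c * b%:Z + 0)%:~R / t%:R : R) * st (d%:~R * a%:R / n%:R : R)).
  apply: eq_bigr => b _; congr (_ * _).
    by rewrite addr0 intrM natrD natrM; congr (st _); field; rewrite tR.
  rewrite -[RHS](sawtoothDz _ (d * b)); congr (st _).
  by rewrite intrM natrD natrM; field.
rewrite -mulr_suml; congr (_ * _).
rewrite (sum_periodic_affine _ t
  (fun i => st (c%:~R * a%:R / (n%:R * t%:R) + i%:~R / t%:R : R))) //.
  rewrite sum_sawtooth_distr //; congr (st _); field; exact/andP.
move=> i z; rewrite -[RHS](sawtoothDz _ z); congr (st _).
by rewrite intrD intrM; field; rewrite tR.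
Qed.

(** This is the substitution x -> c x modulo [N]; [f] is general so that squares and products are
    both covered. *)
Lemma sum_sawtooth_mulr (N : nat) (c d : int) (f : R -> R -> R) :
    (0 < N)%N -> coprimez c N ->
  \sum_(x < N) f (st (c%:~R * x%:R / N%:R))
                 (st (d%:~R * (c%:~R * x%:R) / N%:R))
  = \sum_(x < N) f (st (x%:R / N%:R)) (st (d%:~R * x%:R / N%:R)).
Proof.
move=> N_gt0 co_cN.
have NR : N%:R != 0 :> R by rewrite pnatr_eq0 -lt0n.
pose F (i : int) := f (st (i%:~R / N%:R)) (st (d%:~R * i%:~R / N%:R)).
rewrite -[RHS](sum_periodic_affine _ N F c 0) //.
  by apply: eq_bigr => x _; rewrite /F addr0 intrM.
move=> i z; rewrite /F; congr f.
  by rewrite -[RHS](sawtoothDz _ z); congr (st _); rewrite intrD intrM; field.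
rewrite -[RHS](sawtoothDz _ (d * z)); congr (st _).
by rewrite intrD !intrM; field.
Qed.

(** * Evaluation of S(M, N) from the squared defect *)

Lemma dedekind_S_lift (m : int) (n t : nat) :
    (0 < n)%N -> (0 < t)%N -> coprimez m n ->
    coprimez (m * t%:Z + 1) (n * t)%N -> (m * t%:Z + 1 = m ^+ 2 %[mod n])%Z ->
  dedekind_S R (m * t%:Z + 1) (n * t)%N = t%:R / n%:R + 2 / (n%:R * t%:R) - 3.
Proof.
move=> n_gt0 t_gt0 co_mn co_MN /eqP M_m2.
set M := m * t%:Z + 1 in co_MN M_m2 *.
have nR : n%:R != 0 :> R by rewrite pnatr_eq0 -lt0n.
have tR : t%:R != 0 :> R by rewrite pnatr_eq0 -lt0n.
have N_gt0 : (0 < n * t)%N by rewrite muln_gt0 n_gt0.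
have co_Mt : coprimez M t.
  by move: co_MN; rewrite PoszM coprimezMr => /andP[].
rewrite /dedekind_S dedekind_sumE // natrM.
(* From here [u], [v], [w] denote the sawtooth values at x / N, M x / N and m x / n, not the
   arguments. *)
pose u (x : nat) : R := st (x%:R / (n%:R * t%:R)).
pose v (x : nat) : R := st (M%:~R * x%:R / (n%:R * t%:R)).
pose w (x : nat) : R := st (m%:~R * x%:R / n%:R).
rewrite -/(\sum_(x < n * t) u x * v x).
have uu : \sum_(x < n * t) u x ^+ 2
    = (n%:R * t%:R - 1) * (n%:R * t%:R - 2) / (12 * (n%:R * t%:R)).
  by rewrite -natrM -sum_sawtooth_sqr // natrM.
have vv : \sum_(x < n * t) v x ^+ 2 = \sum_(x < n * t) u x ^+ 2.
  have := sum_sawtooth_mulr (n * t) M 0 (fun a _ => a ^+ 2) N_gt0 co_MN.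
  by rewrite natrM.
(* The summand has period [n] in x, so each of the [t] blocks gives the sum of squares modulo [n],
   [m] being a unit. *)
have ww : \sum_(x < n * t) w x ^+ 2
    = t%:R * ((n%:R - 1) * (n%:R - 2) / (12 * n%:R)).
  rewrite (sum_ord_mul _ _ _ (fun x : nat => w x ^+ 2)) exchange_big /=.
  transitivity (\sum_(b < t) \sum_(a < n) st (a%:R / n%:R : R) ^+ 2).
    apply: eq_bigr => b _.
    rewrite -[RHS](sum_sawtooth_mulr n m 0 (fun a _ => a ^+ 2)) //.
    apply: eq_bigr => a _; congr (_ ^+ 2).
    rewrite /w -[RHS](sawtoothDz _ (m * b)); congr (st _).
    by rewrite intrM natrD natrM; field.
  by rewrite sum_sawtooth_sqr // sumr_const card_ord -[LHS]mulr_natl.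
have uw_vw : \sum_(x < n * t) u x * w x = \sum_(x < n * t) v x * w x.
  transitivity (\sum_(a < n) st (1%:~R * a%:R / n%:R : R)
      * st (m%:~R * a%:R / n%:R)).
    rewrite -(sum_sawtooth_lift n t 1 m) //; last by rewrite /coprimez gcd1z.
    by apply: eq_bigr => x _; rewrite mul1r.
  rewrite (sum_sawtooth_lift n t M m) //.
  transitivity (\sum_(a < n) st (a%:R / n%:R : R)
      * st (m%:~R * a%:R / n%:R)).
    by apply: eq_bigr => x _; rewrite mul1r.
  (* Substituting m a for a turns s(m, n) into the sum of ((m a / n))((m^2 a / n)), and m^2 = M
     modulo n. *)
  rewrite -(sum_sawtooth_mulr n m m ( *%R)) //.
  move: M_m2; rewrite eqz_mod_dvd => /dvdzP[q /eqP].
  rewrite subr_eq => /eqP ->.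
  apply: eq_bigr => a _; rewrite mulrC; congr (_ * _).
  rewrite -[LHS](sawtoothDz _ (q * a)); congr (st _).
  by rewrite intrD !intrM; field.
have sqr : \sum_(x < n * t) (v x - u x - w x) ^+ 2 = (n%:R - 1) * t%:R / 4.
  rewrite (sum_ord_mul _ _ _ (fun x : nat => (v x - u x - w x) ^+ 2)).
  transitivity (\sum_(a < n) \sum_(b < t) if a == 0%N :> nat then 0 else 1 / 4 : R).
    apply: eq_bigr => a _; apply: eq_bigr => b _.
    set x := (a + b * n)%N.
    have nx : (n %| x)%N = (a == 0%N :> nat).
      rewrite /x dvdn_addl ?dvdn_mull //.
      have [->|a0] := eqVneq (a : nat) 0%N; first by rewrite dvdn0.
      by rewrite gtnNdvd ?lt0n.
    have vE : M%:~R * x%:R / (n%:R * t%:R)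
        = x%:R / (n%:R * t%:R) + m%:~R * x%:R / n%:R :> R.
      by rewrite /M intrD intrM; field; rewrite nR.
    have wint : (m%:~R * x%:R / n%:R : R) \is a Num.int = (a == 0%N :> nat).
      by rewrite -[x%:R]/(x%:Z%:~R) -intrM intr_div_int // Gauss_dvdzr 1?coprimez_sym.
    rewrite /u /v /w vE; case: ifPn => [a0|aN0].
      rewrite (sawtooth_int (m%:~R * _ / _)) ?wint //.
      rewrite -wint in a0; case/intrP: a0 => z ->.
      by rewrite sawtoothDz subrr subr0 expr0n.
    (* If n does not divide x, neither x / N nor M x / N is an integer: [M] is a unit modulo N, and
       N | x would give n | x. *)
    apply: sawtoothD_sqr; rewrite ?wint //.
      rewrite -natrM -[x%:R]/(x%:Z%:~R) intr_div_int //.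
      by apply: contra aN0; rewrite -nx => /(dvdn_trans (dvdn_mulr _ _)); exact.
    rewrite -vE -natrM -[x%:R]/(x%:Z%:~R) -intrM intr_div_int //.
    rewrite Gauss_dvdzr 1?coprimez_sym //.
    by apply: contra aN0; rewrite -nx => /(dvdn_trans (dvdn_mulr _ _)); exact.
  case: (n) n_gt0 => // p _; rewrite big_ord_recl /= big1 // add0r.
  rewrite !sumr_const !card_ord -mulrnA -[LHS]mulr_natr natrM -[p.+1%:R]natr1.
  by field.
have : \sum_(x < n * t) (v x - u x - w x) ^+ 2
   = \sum_(x < n * t) v x ^+ 2 + \sum_(x < n * t) u x ^+ 2
     + \sum_(x < n * t) w x ^+ 2 - 2 * \sum_(x < n * t) u x * v x
     - 2 * \sum_(x < n * t) v x * w x + 2 * \sum_(x < n * t) u x * w x.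
  rewrite !mulr_sumr -!sumrN -!big_split /=.
  by apply: eq_bigr => x _; ring.
rewrite uw_vw vv => sqrE.
(* The expanded square is solved for the product sum, the two cross terms with [w] having
   cancelled. *)
have -> : 12 * \sum_(x < n * t) u x * v x = 12 * \sum_(x < n * t) u x ^+ 2
    + 6 * \sum_(x < n * t) w x ^+ 2 - 6 * \sum_(x < n * t) (v x - u x - w x) ^+ 2.
  by rewrite sqrE; ring.
by rewrite uu ww sqr; field; rewrite tR.
Qed.

End Sawtooth.

(** * Arithmetic of the parameters and the bound on E *)

Theorem theorem1 (R : realType) (eps : R) (eps_gt0 : 0 < eps)
    (j k : int) (j_gt0 : 0 < j) (le_jk : j <= k) (co_jk : coprimez j k)
    (m : int) (m_ge : 2 / (k%:~R * eps) + 1 <= m%:~R)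
    (mj1 : (m * j = 1 %[mod k])%Z)
    (l : int) (l_gt0 : 0 < l)
    (n : int) (n_def : n = k * (m ^+ 2 + 1))
    (t : int) (t_def : t = 2 * m + l * n - j * (m ^+ 2 + 1)) :
  exists E : R,
    [/\ 0 < E, E < eps
      & dedekind_S R (m * t + 1) (n * t) =
        l%:~R - 3 - j%:~R / k%:~R + E].
Proof.
have k_gt0 : 0 < k := lt_le_trans j_gt0 le_jk.
have kR : 0 < k%:~R :> R by rewrite ltr0z.
have m1R : 1 < m%:~R :> R.
  by apply: lt_le_trans m_ge; rewrite ltrDr divr_gt0 // mulr_gt0.
have m_gt1 : 1 < m by rewrite -(ltr1z R).
have n_gt0 : 0 < n by rewrite n_def; nia.
(* Since l >= 1 and j <= k, l n >= j (m^2 + 1), so t >= 2 m. *)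
have t_gt0 : 0 < t by rewrite t_def n_def; nia.
have [u uE] : exists u, m * j = u * k + 1.
  move/eqP: mj1; rewrite eqz_mod_dvd => /dvdzP[u /eqP]; rewrite subr_eq => /eqP.
  by exists u.
have co_mn : coprimez m n.
  rewrite n_def coprimezMr; apply/andP; split; apply/coprimezP.
    by exists (j, - u) => /=; rewrite mulrC uE; ring.
  by exists (- m, 1) => /=; ring.
(* Replacing m j by u k + 1 in m t + 1 leaves m^2 plus a multiple of n = k (m^2 + 1). *)
have ME : m * t + 1 = (l * m - u) * n + m ^+ 2.
  transitivity (2 * m ^+ 2 + l * m * n - (m * j) * (m ^+ 2 + 1) + 1).
    by rewrite t_def; ring.
  by rewrite uE n_def; ring.
have co_MN : coprimez (m * t + 1) (n * t).
  rewrite coprimezMr; apply/andP; split.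
    by rewrite ME coprimez_sym /coprimez gcdzMDl -/(coprimez _ _)
      coprimez_pexpr // coprimez_sym.
  by apply/coprimezP; exists (1, - m) => /=; ring.
have M_m2 : (m * t + 1 = m ^+ 2 %[mod n])%Z by rewrite ME modzMDl.
have tR : 0 < t%:~R :> R by rewrite ltr0z.
have nR : 0 < n%:~R :> R by rewrite ltr0z.
have SE : dedekind_S R (m * t + 1) (n * t)
    = t%:~R / n%:~R + 2 / (n%:~R * t%:~R) - 3.
  move: n_gt0 t_gt0 co_mn co_MN M_m2; clear.
  case: n t => [n|//] [t|//] n0 t0 co_mn co_MN M_m2.
  by rewrite -PoszM dedekind_S_lift.
have nE : n%:~R = k%:~R * (m%:~R ^+ 2 + 1) :> R.
  by rewrite n_def; ring.
(* This is what remains after t / n = l - j / k + 2 m / n is inserted in [SE]. *)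
exists (2 * m%:~R / n%:~R + 2 / (n%:~R * t%:~R)); split.
- have ? := lt_trans ltr01 m1R.
  by rewrite addr_gt0 // divr_gt0 // mulr_gt0.
- have t1R : 1 <= t%:~R :> R by rewrite ler1z.
  have Ele : 2 * m%:~R / n%:~R + 2 / (n%:~R * t%:~R)
      <= 2 * (m%:~R + 1) / n%:~R :> R.
    rewrite mulrDr mulrDl lerD2l mulr1 ler_pM2l // lef_pV2 ?posrE ?mulr_gt0 //.
    by rewrite ler_peMr // ltW.
  apply: le_lt_trans Ele _; rewrite ltr_pdivrMr // nE.
  (* The lower bound on [m] says 2 <= (m - 1) k eps; multiplied by m + 1 it gives 2 (m + 1) <= (m^2
     - 1) k eps < n eps. *)
  have : 2 <= (m%:~R - 1) * (k%:~R * eps) :> R.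
    by rewrite -ler_pdivrMr ?mulr_gt0 // lerBrDr.
  rewrite -(ler_pM2r (_ : 0 < m%:~R + 1)); last lra.
  move=> /le_lt_trans; apply.
  have : 0 < k%:~R * eps by rewrite mulr_gt0.
  nra.
- rewrite SE.
  have m2R : m%:~R ^+ 2 + 1 != 0 :> R by rewrite gt_eqF // ltr_wpDl ?sqr_ge0.
  have -> : t%:~R / n%:~R = l%:~R - j%:~R / k%:~R + 2 * m%:~R / n%:~R :> R.
    have -> : t%:~R = 2 * m%:~R + l%:~R * n%:~R - j%:~R * (m%:~R ^+ 2 + 1) :> R.
      by rewrite t_def; ring.
    by rewrite nE; field; rewrite m2R gt_eqF.
  by ring.
Qed.
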